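(* Let $\mathfrak{A}=\{\mathfrak{a}_1,\dots,\mathfrak{a}_n\}$ and $\mathfrak{B}=\{\mathfrak{b}_1,\dots,\mathfrak{b}_n\}$ be sets of applied ML systems such that each $\mathfrak{a}_i$ is Justifiably Trustworthy with respect to $\mathfrak{b}_i$. If $\mathfrak{a}_1,\dots,\mathfrak{a}_n\mapsto^{cstr}\mathfrak{c}$ and $\mathfrak{b}_1,\dots,\mathfrak{b}_n\mapsto^{cstr}\mathfrak{d}$, or $\mathfrak{a}_1,\dots,\mathfrak{a}_n\mapsto^{decstr}\mathfrak{c}$ and $\mathfrak{b}_1,\dots,\mathfrak{b}_n\mapsto^{decstr}\mathfrak{d}$, and the target variable of $\mathfrak{d}$ is identical to that of $\mathfrak{c}$, then for every possible value $\delta$, $\mathfrak{c}:\delta_f$ iff $\mathfrak{d}:\delta_f$; hence $\mathfrak{c}$ is Justifiably Trustworthy with respect to $\mathfrak{d}$.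
   Context: TNDPQ. Atomic variables $a$ each have finitely many atomic values $\alpha^1,\dots,\alpha^n$, exhaustive and pairwise mutually exclusive. Variables: atomic variables closed under pairing $\langle t,u\rangle$ and conditional $[t]u$, with projections $fst(\langle t,u\rangle)=t$, $snd(\langle t,u\rangle)=u$. Values: atomic values closed under $\beta^{\bot}$, $\beta+\delta$, $\beta\times\delta$, $\beta\to\delta$. A list $\sigma$ consists of value attributions $a:\beta$. An applied ML system $\mathfrak{a}$ is a Training Set $\Gamma$, Learning Algorithm $A$, list $\sigma$ and target variable $t$; $\mathfrak{a}:\beta_f$ (also $\sigma\rhd t:\beta_f$) means the system gives probability $f$ to $t$ receiving value $\beta$ for individuals described by $\sigma$. Values $\beta,\delta$ are mutually exclusive for $t$ ($t:\beta\perp t:\delta$) iff $\beta\times\delta\to\bot$ is provable in classical propositional logic (reading $\times,+,\bot,\to$ as $\wedge,\vee,\neg,\to$) extended, for each atomic $a$ in $t$, by $\neg(\alpha^i\wedge\alpha^j)$ ($i\neq j$) and $\bigvee_i\alpha^i$. Right I-rules (same $\Gamma,A$ in premises and conclusion): I$\to$: $\sigma,t:\beta\rhd u:\delta_g\ /\ \sigma\rhd[t]u:(\beta\to\delta)_g$; I$\times$1: $\sigma,t:\beta\rhd u:\delta_g$ and $\sigma\rhd t:\beta_f\ /\ \sigma\rhd\langle t,u\rangle:(\beta\times\delta)_{f g}$; I$\times$2: $\sigma,u:\delta\rhd t:\beta_g$ and $\sigma\rhd u:\delta_f\ /\ \sigma\rhd\langle t,u\rangle:(\beta\times\delta)_{fg}$;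 I$\rhd+$: $\sigma\rhd u:\delta_f$, $\sigma\rhd u:\gamma_g$, $u:\delta\perp u:\gamma\ /\ \sigma\rhd u:(\delta+\gamma)_{f+g}$; I$\rhd\bot$: $\sigma\rhd u:\delta_g\ /\ \sigma\rhd u:\delta^\bot_{1-g}$. Right E-rules: inverse of I$\to$; E$\times$1a: $\sigma\rhd t:(\beta\times\delta)_f$ and $\sigma,fst(t):\beta\rhd snd(t):\delta_g$ ($g\ne0$) $/\ \sigma\rhd fst(t):\beta_{f/g}$; E$\times$1b: $\sigma\rhd t:(\beta\times\delta)_f$ and $\sigma\rhd fst(t):\beta_g$ ($g\neq0$) $/\ \sigma,fst(t):\beta\rhd snd(t):\delta_{f/g}$; E$\times$2a/2b: same with $fst(t):\beta$ and $snd(t):\delta$ swapped; E$\rhd+$a: $\sigma\rhd u:(\delta+\gamma)_h$ and $\sigma\rhd u:\delta_f\ /\ \sigma\rhd u:\gamma_{h-f}$; E$\rhd+$b symmetric; inverse of I$\rhd\bot$. $\mathfrak{a}_1,\dots,\mathfrak{a}_n\mapsto^{cstr}\mathfrak{b}$ (logical construction) iff for some values $\beta^i,\delta$ and probabilities $f_i,h$, $\mathfrak{b}:\delta_h$ is derivable from $\mathfrak{a}_1:\beta^1_{f_1},\dots,\mathfrak{a}_n:\beta^n_{f_n}$ using only right I-rules; $\mapsto^{decstr}$ (logical deconstruction) likewise with only right E-rules. For applied systems $\mathfrak{a}$ (copy) and $\mathfrak{b}$ (original) with the same target variable $t$ and same $\sigma$, differing in Learning Algorithm or Training Set: $\mathfrak{a}$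 is Justifiably Trustworthy (JT) w.r.t. $\mathfrak{b}$ iff for every possible value $\beta$ of $t$, $\mathfrak{a}:\beta_f$ iff $\mathfrak{b}:\beta_f$.
   Formalization: For deconstruction, c and d are also assumed to have the same list σ (otherwise the claim fails, e.g. by the inverse of I→); and ''c:δ_f'', ''d:δ_f'' are read as derivability from outputs of the a_i, b_i by the same class of rules, since outputs not fixed by the construction could differ. *)

(* Defs.v *)
From Stdlib Require List.
From HB Require Import structures.
From mathcomp Require Import all_boot all_order all_algebra.
From mathcomp Require Import interval_inference reals.
Set Implicit Arguments.
Unset Strict Implicit.
Unset Printing Implicit Defensive.
Import Order.TTheory GRing.Theory Num.Theory.
Local Open Scope ring_scope.

Record signature := Signature {
  avar : eqType;
  nval : avar -> nat;
  nval_gt0 : forall a, (0 < nval a)%N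
}.

(* The atomic value alpha^i of a is tagged with a, so that distinct atomic
   variables never share an atomic value. *)
Definition avalue (S : signature) : Type := {a : avar S & 'I_(nval a)}.

Definition aval (S : signature) (a : avar S) (i : 'I_(nval a)) : avalue S :=
  existT _ a i.

(* There is no constructor for fst and snd: they are only available on pairs,
   where they compute, so the rules below mention t and u in place of
   fst <t, u> and snd <t, u>. [Cond t u] is the variable [t]u. *)
Inductive variable (S : signature) : Type :=
| Atom of avar S
| Pair of variable S & variable S
| Cond of variable S & variable S.

Inductive value (S : signature) : Type :=
| VAtom of avalue S
| VNot of value S
| VPlus of value S & value S
| VTimes of value S & value S
| VImp of value S & value S.

Fixpoint avars (S : signature) (t : variable S) : seq (avar S) :=
  match t with
  | Atom a => [:: a]
  | Pair t u | Cond t u => avars t ++ avars u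
  end.

Fixpoint possible (S : signature) (t : variable S) (b : value S) : bool :=
  match b with
  | VAtom x => if t is Atom a then a == tag x else false
  | VNot b => possible t b
  | VPlus b d => possible t b && possible t d
  | VTimes b d => if t is Pair t u then possible t b && possible u d else false
  | VImp b d => if t is Cond t u then possible t b && possible u d else false
  end.

Inductive form (S : signature) : Type :=
| FAtom of avalue S
| FFalse
| FAnd of form S & form S
| FOr of form S & form S
| FImp of form S & form S.
Arguments FFalse {S}.

Definition FNot (S : signature) (A : form S) : form S := FImp A FFalse.

Fixpoint form_of (S : signature) (b : value S) : form S :=
  match b with
  | VAtom x => FAtom x
  | VNot b => FNot (form_of b)
  | VPlus b d => FOr (form_of b) (form_of d)
  | VTimes b d => FAnd (form_of b) (form_of d)
  | VImp b d => FImp (form_of b) (form_of d)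
  end.

(* Classical natural deduction, with extra axioms Ax. *)
Inductive provable (S : signature) (Ax : form S -> Prop) :
    seq (form S) -> form S -> Prop :=
| P_axiom G A : Ax A -> provable Ax G A
| P_hyp G A : List.In A G -> provable Ax G A
| P_andI G A B : provable Ax G A -> provable Ax G B -> provable Ax G (FAnd A B)
| P_andEl G A B : provable Ax G (FAnd A B) -> provable Ax G A
| P_andEr G A B : provable Ax G (FAnd A B) -> provable Ax G B
| P_orIl G A B : provable Ax G A -> provable Ax G (FOr A B)
| P_orIr G A B : provable Ax G B -> provable Ax G (FOr A B)
| P_orE G A B C : provable Ax G (FOr A B) -> provable Ax (A :: G) C ->
    provable Ax (B :: G) C -> provable Ax G C
| P_impI G A B : provable Ax (A :: G) B -> provable Ax G (FImp A B)
| P_impE G A B : provable Ax G (FImp A B) -> provable Ax G A -> provable Ax G B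
| P_raa G A : provable Ax (FNot A :: G) FFalse -> provable Ax G A.

Inductive atomic_axiom (S : signature) (t : variable S) : form S -> Prop :=
| Ax_exclusive (a : avar S) (i j : 'I_(nval a)) :
    a \in avars t -> i != j ->
    atomic_axiom t (FNot (FAnd (FAtom (aval i)) (FAtom (aval j))))
| Ax_exhaustive (a : avar S) :
    a \in avars t ->
    atomic_axiom t
      (foldr (@FOr S) FFalse [seq FAtom (aval i) | i <- enum 'I_(nval a)]).

Definition exclusive (S : signature) (t : variable S) (b d : value S) : Prop :=
  provable (atomic_axiom t) [::] (FImp (form_of (VTimes b d)) FFalse).

(* The list sigma is ordered; "sigma, t : b" adds t : b at the right end. *)
Record system (S : signature) (TS LA : Type) := Sys {
  training : TS;
  algorithm : LA;
  descr : seq (variable S * value S);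
  target : variable S
}.

Record judgement (R : realType) (S : signature) (TS LA : Type) := Jud {
  jsys : system S TS LA;
  jval : value S;
  jprob : {i01 R}
}.

Inductive right_I (R : realType) (S : signature) (TS LA : Type) :
    seq (judgement R S TS LA) -> judgement R S TS LA -> Prop :=
| I_imp G A s t u b d (g : {i01 R}) :
    right_I [:: Jud (Sys G A (rcons s (t, b)) u) d g]
            (Jud (Sys G A s (Cond t u)) (VImp b d) g)
| I_times1 G A s t u b d (f g h : {i01 R}) :
    h%:num = f%:num * g%:num ->
    right_I [:: Jud (Sys G A (rcons s (t, b)) u) d g;
                Jud (Sys G A s t) b f]
            (Jud (Sys G A s (Pair t u)) (VTimes b d) h)
| I_times2 G A s t u b d (f g h : {i01 R}) :
    h%:num = f%:num * g%:num ->
    right_I [:: Jud (Sys G A (rcons s (u, d)) t) b g;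
                Jud (Sys G A s u) d f]
            (Jud (Sys G A s (Pair t u)) (VTimes b d) h)
| I_plus G A s u d c (f g h : {i01 R}) :
    exclusive u d c ->
    h%:num = f%:num + g%:num ->
    right_I [:: Jud (Sys G A s u) d f; Jud (Sys G A s u) c g]
            (Jud (Sys G A s u) (VPlus d c) h)
| I_not G A s u d (g h : {i01 R}) :
    h%:num = 1 - g%:num ->
    right_I [:: Jud (Sys G A s u) d g] (Jud (Sys G A s u) (VNot d) h).

Inductive right_E (R : realType) (S : signature) (TS LA : Type) :
    seq (judgement R S TS LA) -> judgement R S TS LA -> Prop :=
| E_imp G A s t u b d (g : {i01 R}) :
    right_E [:: Jud (Sys G A s (Cond t u)) (VImp b d) g]
            (Jud (Sys G A (rcons s (t, b)) u) d g)
| E_times1a G A s t u b d (f g h : {i01 R}) :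
    g%:num != 0 -> h%:num = f%:num / g%:num ->
    right_E [:: Jud (Sys G A s (Pair t u)) (VTimes b d) f;
                Jud (Sys G A (rcons s (t, b)) u) d g]
            (Jud (Sys G A s t) b h)
| E_times1b G A s t u b d (f g h : {i01 R}) :
    g%:num != 0 -> h%:num = f%:num / g%:num ->
    right_E [:: Jud (Sys G A s (Pair t u)) (VTimes b d) f;
                Jud (Sys G A s t) b g]
            (Jud (Sys G A (rcons s (t, b)) u) d h)
| E_times2a G A s t u b d (f g h : {i01 R}) :
    g%:num != 0 -> h%:num = f%:num / g%:num ->
    right_E [:: Jud (Sys G A s (Pair t u)) (VTimes b d) f;
                Jud (Sys G A (rcons s (u, d)) t) b g]
            (Jud (Sys G A s u) d h)
| E_times2b G A s t u b d (f g h : {i01 R}) :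
    g%:num != 0 -> h%:num = f%:num / g%:num ->
    right_E [:: Jud (Sys G A s (Pair t u)) (VTimes b d) f;
                Jud (Sys G A s u) d g]
            (Jud (Sys G A (rcons s (u, d)) t) b h)
| E_plusa G A s u d c (f h k : {i01 R}) :
    k%:num = h%:num - f%:num ->
    right_E [:: Jud (Sys G A s u) (VPlus d c) h; Jud (Sys G A s u) d f]
            (Jud (Sys G A s u) c k)
| E_plusb G A s u d c (f h k : {i01 R}) :
    k%:num = h%:num - f%:num ->
    right_E [:: Jud (Sys G A s u) (VPlus d c) h; Jud (Sys G A s u) c f]
            (Jud (Sys G A s u) d k)
| E_not G A s u d (g h : {i01 R}) :
    h%:num = 1 - g%:num ->
    right_E [:: Jud (Sys G A s u) (VNot d) h] (Jud (Sys G A s u) d g).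

(* [derivation rule l j]: j has a derivation whose open assumptions, from left
   to right, are exactly l. *)
Inductive derivation (J : Type) (rule : seq J -> J -> Prop) :
    seq J -> J -> Prop :=
| D_assume j : derivation rule [:: j] j
| D_unary l p j :
    rule [:: p] j -> derivation rule l p -> derivation rule l j
| D_binary l1 l2 p1 p2 j :
    rule [:: p1; p2] j -> derivation rule l1 p1 -> derivation rule l2 p2 ->
    derivation rule (l1 ++ l2) j.

(* [mapsto rule a b]: some b : d_h has a derivation from the assumptions
   a_i : beta^i_(f_i), each of which occurs in it (at least once). *)
Definition mapsto (R : realType) (S : signature) (TS LA : Type)
    (rule : seq (judgement R S TS LA) -> judgement R S TS LA -> Prop)
    (n : nat) (a : 'I_n -> system S TS LA) (b : system S TS LA) : Prop :=
  exists (beta : 'I_n -> value S) (f : 'I_n -> {i01 R})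
         (d : value S) (h : {i01 R}) (l : seq (judgement R S TS LA)),
    (forall j, List.In j l <-> exists i, j = Jud (a i) (beta i) (f i)) /\
    derivation rule l (Jud b d h).

Definition mapsto_cstr (R : realType) (S : signature) (TS LA : Type)
    (n : nat) (a : 'I_n -> system S TS LA) (b : system S TS LA) : Prop :=
  mapsto (@right_I R S TS LA) a b.

Definition mapsto_decstr (R : realType) (S : signature) (TS LA : Type)
    (n : nat) (a : 'I_n -> system S TS LA) (b : system S TS LA) : Prop :=
  mapsto (@right_E R S TS LA) a b.

(* The judgements b : d_h of a system b obtained from a_1, ..., a_n by the
   rules: those derivable from the outputs a_i : beta_f of the a_i, where
   [out a beta f] reads a : beta_f. *)
Definition derived_out (R : realType) (S : signature) (TS LA : Type)
    (rule : seq (judgement R S TS LA) -> judgement R S TS LA -> Prop)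
    (out : system S TS LA -> value S -> {i01 R} -> Prop)
    (n : nat) (a : 'I_n -> system S TS LA) :
    system S TS LA -> value S -> {i01 R} -> Prop :=
  fun b d h => exists l : seq (judgement R S TS LA),
    (forall j, List.In j l -> exists (i : 'I_n) (beta : value S) (f : {i01 R}),
       [/\ j = Jud (a i) beta f, possible (target (a i)) beta
         & out (a i) beta f]) /\
    derivation rule l (Jud b d h).

Definition cstr_out (R : realType) (S : signature) (TS LA : Type)
    (out : system S TS LA -> value S -> {i01 R} -> Prop)
    (n : nat) (a : 'I_n -> system S TS LA) :
    system S TS LA -> value S -> {i01 R} -> Prop :=
  derived_out (@right_I R S TS LA) out a.

Definition decstr_out (R : realType) (S : signature) (TS LA : Type)
    (out : system S TS LA -> value S -> {i01 R} -> Prop)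
    (n : nat) (a : 'I_n -> system S TS LA) :
    system S TS LA -> value S -> {i01 R} -> Prop :=
  derived_out (@right_E R S TS LA) out a.

(* The copy a is Justifiably Trustworthy with respect to the original b, the
   judgements a : beta_f and b : beta_f being those of outa and outb. *)
Definition JT (R : realType) (S : signature) (TS LA : Type)
    (outa outb : system S TS LA -> value S -> {i01 R} -> Prop)
    (a b : system S TS LA) : Prop :=
  [/\ target a = target b,
      descr a = descr b,
      algorithm a <> algorithm b \/ training a <> training b
    & forall beta, possible (target a) beta ->
        forall f, outa a beta f <-> outb b beta f].

(* Main.v *)
From Stdlib Require List.
Require Import Defs.
From HB Require Import structures.
From mathcomp Require Import all_boot all_order all_algebra.
From mathcomp Require Import interval_inference reals.
Set Implicit Arguments.
Unset Strict Implicit.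
Unset Printing Implicit Defensive.

(** All rules keep the Training Set and the Learning Algorithm, so replacing
    these throughout a derivation from the [a_i] yields one from the [b_i]; what
    remains is that [c] and [d] have the same description. For the right
    I-rules, attach to a system the variables of its description followed by the
    antecedents t_1, ..., t_k of its target [t_1]...[t_k]v, with v not
    conditional. The string of the conclusion is the longest common prefix of
    the strings of the open assumptions: I-> does not change it, and at I× the
    major premise continues it with t, the minor one, if at all, with a strict
    subterm of t. As [c] and [d] have the same target and their assumptions the
    same strings, their descriptions have the same length; both being initial
    segments of the description of one assumption, they are equal. *)

Lemma In_cat (T : Type) (x : T) (s1 s2 : seq T) :
  List.In x (s1 ++ s2) <-> List.In x s1 \/ List.In x s2.
Proof. by elim: s1 => [|y s1 IH] /=; tauto. Qed.

Lemma In_map (T U : Type) (f : T -> U) (y : U) (s : seq T) :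
  List.In y (map f s) <-> exists2 x, List.In x s & y = f x.
Proof.
elim: s => [|z s IH] /=; first by split=> // -[].
split=> [[yE|/IH[x xs yE]]|[x [<-|xs] yE]].
- by exists z => //; left.
- by exists x => //; right.
- by left.
- by right; apply/IH; exists x.
Qed.

(** * Initial segments and longest common prefixes *)

Definition extends (T : Type) (w x : seq T) : Prop := exists r, x = w ++ r.

Lemma extends_cat (T : Type) (w r x : seq T) : extends (w ++ r) x -> extends w x.
Proof. by case=> r' ->; exists (r ++ r'); rewrite catA. Qed.

Lemma extends_rcons (T : Type) (w x : seq T) (y : T) :
  extends (rcons w y) x -> extends w x.
Proof. by rewrite -cats1; apply: extends_cat. Qed.

Lemma extends_size_eq (T : Type) (w1 w2 x : seq T) :
  extends w1 x -> extends w2 x -> size w1 = size w2 -> w1 = w2.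
Proof.
move=> [r1 ->] [r2 e] sz.
by have := congr1 (take (size w1)) e; rewrite take_size_cat // sz take_size_cat.
Qed.

Lemma extends_total (T : Type) (w1 w2 x : seq T) :
  extends w1 x -> extends w2 x -> extends w1 w2 \/ extends w2 w1.
Proof.
move=> [r1 ->]; elim: w1 w2 => [|y w1 IH] [|z w2] /=.
- by move=> _; left; exists [::].
- by move=> _; left; exists (z :: w2).
- by move=> _; right; exists (y :: w1).
- case=> r2 [<- e]; case: (IH w2); first by exists r2.
  + by case=> r ->; left; exists r.
  + by case=> r ->; right; exists r.
Qed.

Lemma extends_rcons_inj (T : Type) (w x : seq T) (y z : T) :
  extends (rcons w y) x -> extends (rcons w z) x -> y = z.
Proof.
move=> ey ez; have/rcons_inj[//] : rcons w y = rcons w z.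
by apply: extends_size_eq ey ez _; rewrite !size_rcons.
Qed.

Definition is_lcp (T : Type) (P : seq T -> Prop) (w : seq T) : Prop :=
  [/\ exists x, P x, forall x, P x -> extends w x
    & forall y, ~ (forall x, P x -> extends (rcons w y) x)].

(** Two common prefixes of one string are comparable. If one were properly shorter, its next letter
    in the other would contradict its maximality. *)
Lemma is_lcp_uniq (T : Type) (P : seq T -> Prop) (w1 w2 : seq T) :
  is_lcp P w1 -> is_lcp P w2 -> w1 = w2.
Proof.
have aux v1 v2 : is_lcp P v1 -> is_lcp P v2 -> extends v1 v2 -> v1 = v2.
  move=> [_ _ max1] [_ ext2 _] [[|y r] e]; first by rewrite e cats0.
  by case: (max1 y) => x Px; apply: (@extends_cat _ _ r); rewrite cat_rcons -e; apply: ext2.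
move=> lcp1 lcp2; have [[x Px] ext1 _] := lcp1; have [_ ext2 _] := lcp2.
case: (extends_total (ext1 x Px) (ext2 x Px)); first exact: aux.
by move=> e; apply/esym/aux.
Qed.

Lemma is_lcp_same (T : Type) (P Q : seq T -> Prop) (w : seq T) :
  is_lcp P w -> is_lcp Q w -> is_lcp (fun x => P x \/ Q x) w.
Proof.
move=> [[x Px] extP maxP] [_ extQ _]; split.
- by exists x; left.
- by move=> z [/extP|/extQ].
- by move=> y ext; apply: (maxP y) => z Pz; apply: ext; left.
Qed.

(** Strings in [P] continue [w] with [y], so a longer common prefix would have to start with
    [rcons w y]. Strings in [Q] rule this out: they continue [w] with the head of [r2], which is not
    [y], or, if [r2] is empty, [w] is already maximal for them. *)
Lemma is_lcp_fork (T : Type) (P Q : seq T -> Prop) (w r1 r2 : seq T) (y : T) :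
  is_lcp P (rcons w y ++ r1) -> is_lcp Q (w ++ r2) ->
  (forall r, r2 <> y :: r) -> is_lcp (fun x => P x \/ Q x) w.
Proof.
move=> [[x Px] extP _] [[x' Qx'] extQ maxQ] r2y; split.
- by exists x; left.
- move=> z [Pz|Qz]; last exact: extends_cat (extQ z Qz).
  exact: extends_rcons (extends_cat (extP z Pz)).
move=> z ext.
have yz : y = z.
  by apply: (@extends_rcons_inj _ w x); [apply: extends_cat (extP x Px)|apply: ext; left].
rewrite -{z}yz in ext.
case: r2 r2y extQ maxQ => [|z r2] r2y extQ maxQ.
  by apply: (maxQ y) => v Qv; rewrite cats0; apply: ext; right.
apply: (r2y r2); congr (_ :: _); apply: (@extends_rcons_inj _ w x').
  by apply: extends_cat (_ : extends (rcons w z ++ r2) x'); rewrite cat_rcons; apply: extQ.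
by apply: ext; right.
Qed.

Lemma is_lcp_ext (T : Type) (P Q : seq T -> Prop) (w : seq T) :
  (forall x, P x <-> Q x) -> is_lcp P w -> is_lcp Q w.
Proof.
move=> PQ [[x Px] ext max]; split; first by exists x; apply/PQ.
- by move=> z /PQ/ext.
- by move=> y extQ; apply: (max y) => z /PQ/extQ.
Qed.

(** * Strings and descriptions along right I-rules *)

Fixpoint antecedents (S : signature) (t : variable S) : seq (variable S) :=
  if t is Cond t u then t :: antecedents u else [::].

(** The first antecedent is a proper subterm of [t]. This is the side condition of [is_lcp_fork] at
    the two I× rules. *)
Lemma antecedents_head (S : signature) (t : variable S) r :
  antecedents t <> t :: r.
Proof.
have ncond v : forall u : variable S, v <> Cond v u.
  by elim: v => // v IH u _ w [e _]; apply: (IH u).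
by case: t => //= t u [/ncond].
Qed.

(** Values are dropped because I→ moves [t] into the target but its value into the value of the
    judgement. *)
Definition sys_string (S : signature) (TS LA : Type) (a : system S TS LA) :
    seq (variable S) :=
  map fst (descr a) ++ antecedents (target a).

Definition open_string (R : realType) (S : signature) (TS LA : Type)
    (l : seq (judgement R S TS LA)) (x : seq (variable S)) : Prop :=
  exists2 j, List.In j l & x = sys_string (jsys j).

Lemma open_string_cat (R : realType) (S : signature) (TS LA : Type)
    (l1 l2 : seq (judgement R S TS LA)) x :
  open_string l1 x \/ open_string l2 x <-> open_string (l1 ++ l2) x.
Proof.
split=> [[[j jl ->]|[j jl ->]]|[j /In_cat[jl|jl] ->]].
- by exists j => //; apply/In_cat; left.
- by exists j => //; apply/In_cat; right.
- by left; exists j.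
- by right; exists j.
Qed.

Lemma right_I_lcp (R : realType) (S : signature) (TS LA : Type)
    (l : seq (judgement R S TS LA)) j :
  derivation (@right_I R S TS LA) l j ->
  is_lcp (open_string l) (sys_string (jsys j)).
Proof.
elim=> {l j} [j|l p j rul _|l1 l2 p1 p2 j rul _ lcp1 _ lcp2].
- split; first by exists (sys_string (jsys j)); exists j => //; left.
  + by move=> x [_ [<-|[]] ->]; exists [::]; rewrite cats0.
  (* A string has no proper prolongation as a prefix of itself, by length. *)
  + move=> y /(_ (sys_string (jsys j))); case; first by exists j => //; left.
    move=> r /(congr1 size); rewrite size_cat size_rcons => /eqP.
    by rewrite addSnnS -[X in X == _]addn0 eqn_add2l.
- by inversion rul; subst => //=; rewrite /sys_string /= map_rcons cat_rcons.
apply: is_lcp_ext (@open_string_cat _ _ _ _ _ _) _.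
inversion rul; subst; rewrite /sys_string /= ?map_rcons ?cats0 in lcp1 lcp2 *.
- exact: is_lcp_fork lcp1 lcp2 (@antecedents_head _ _).
- exact: is_lcp_fork lcp1 lcp2 (@antecedents_head _ _).
- exact: is_lcp_same lcp1 lcp2.
Qed.

(** From premise to conclusion a right I-rule keeps the list or removes its last attribution. This
    recovers the values that [sys_string] forgets. *)
Lemma right_I_descr (R : realType) (S : signature) (TS LA : Type)
    (l : seq (judgement R S TS LA)) j :
  derivation (@right_I R S TS LA) l j ->
  forall p, List.In p l -> extends (descr (jsys j)) (descr (jsys p)).
Proof.
elim=> {l j} [j p [<-|[]]|l q j rul _ IH p /IH|
  l1 l2 p1 p2 j rul _ IH1 _ IH2 p /In_cat[/IH1|/IH2]].
- by exists [::]; rewrite cats0.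
- by inversion rul; subst => //= e; apply: extends_rcons e.
- by inversion rul; subst => //= e; apply: extends_rcons e.
- by inversion rul; subst.
Qed.

(** * Change of Training Set and Learning Algorithm in a derivation *)

Definition retag (R : realType) (S : signature) (TS LA : Type) (G : TS) (A : LA)
    (j : judgement R S TS LA) : judgement R S TS LA :=
  Jud (Sys G A (descr (jsys j)) (target (jsys j))) (jval j) (jprob j).

(** The common feature of I- and E-rules on which the transfer of derivations rests, so that
    construction and deconstruction are treated at once. *)
Definition uniform_rule (R : realType) (S : signature) (TS LA : Type)
    (rule : seq (judgement R S TS LA) -> judgement R S TS LA -> Prop) : Prop :=
  forall ps j, rule ps j ->
  (forall p, List.In p ps -> training (jsys p) = training (jsys j) /\
                             algorithm (jsys p) = algorithm (jsys j)) /\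
  (forall G A, rule (map (retag G A) ps) (retag G A j)).

Lemma right_I_uniform (R : realType) (S : signature) (TS LA : Type) :
  uniform_rule (@right_I R S TS LA).
Proof.
move=> ps j; case=> * /=; split=> [p|G' A']; try by move=> /=; intuition subst.
all: by econstructor; eauto.
Qed.

Lemma right_E_uniform (R : realType) (S : signature) (TS LA : Type) :
  uniform_rule (@right_E R S TS LA).
Proof.
move=> ps j; case=> * /=; split=> [p|G' A']; try by move=> /=; intuition subst.
all: by econstructor; eauto.
Qed.

Section UniformRule.
Context (R : realType) (S : signature) (TS LA : Type).
Context (rule : seq (judgement R S TS LA) -> judgement R S TS LA -> Prop).
Hypothesis unif : uniform_rule rule.

Lemma derivation_tags l j : derivation rule l j ->
  forall p, List.In p l -> training (jsys p) = training (jsys j) /\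
                           algorithm (jsys p) = algorithm (jsys j).
Proof.
elim=> {l j} [j p [<-|[]] //|l q j /unif[tags _] _ IH p /IH[-> ->]|
  l1 l2 p1 p2 j /unif[tags _] _ IH1 _ IH2 p /In_cat[/IH1|/IH2][-> ->]];
  by apply: tags; rewrite /=; tauto.
Qed.

Lemma derivation_retag G A l j :
  derivation rule l j -> derivation rule (map (retag G A) l) (retag G A j).
Proof.
elim=> {l j} [j|l p j /unif[_ rul] _|l1 l2 p1 p2 j /unif[_ rul] _ IH1 _ IH2] /=.
- exact: D_assume.
- exact: D_unary (rul G A).
- by rewrite map_cat; apply: D_binary (rul G A) IH1 IH2.
Qed.

Lemma derivation_nonempty l j : derivation rule l j -> exists p, List.In p l.
Proof.
elim=> {l j} [j|//|l1 l2 p1 p2 j _ _ [p pl] _ _]; first by exists j; left.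
by exists p; apply/In_cat; left.
Qed.

Lemma mapsto_inhabited n (a : 'I_n -> system S TS LA) c :
  mapsto rule a c -> inhabited 'I_n.
Proof.
by case=> beta [f [v [h [l [lP der]]]]]; case: (derivation_nonempty der) => p /lP[].
Qed.

Lemma mapsto_tags n (a : 'I_n -> system S TS LA) c : mapsto rule a c ->
  forall i, training (a i) = training c /\ algorithm (a i) = algorithm c.
Proof.
case=> beta [f [v [h [l [lP der]]]]] i.
by apply: (derivation_tags der (p := Jud (a i) (beta i) (f i))); apply/lP; exists i.
Qed.

(** Each [b i] has the Training Set and Learning Algorithm of [d], so retagging with these turns
    assumptions on [a i] into assumptions on [b i]. Only one inclusion of outputs is asked for, so
    that the lemma serves both directions of the equivalence. *)
Lemma derived_out_retag (outa outb : system S TS LA -> value S -> {i01 R} -> Prop)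
    n (a b : 'I_n -> system S TS LA) c d v h :
  (forall i, descr (a i) = descr (b i)) ->
  (forall i, target (a i) = target (b i)) ->
  (forall i, training (b i) = training d /\ algorithm (b i) = algorithm d) ->
  (forall i v f, possible (target (a i)) v -> outa (a i) v f -> outb (b i) v f) ->
  descr c = descr d -> target c = target d ->
  derived_out rule outa a c v h -> derived_out rule outb b d v h.
Proof.
move=> dab tab tags oab dcd tcd [l [lP der]].
exists (map (retag (training d) (algorithm d)) l); split=> [j /In_map[p pl ->]|].
  have [i [beta [f [-> pos o]]]] := lP p pl.
  exists i, beta, f; split; [|by rewrite -tab|exact: oab].
  rewrite /retag /= dab tab; have [<- <-] := tags i; by case: (b i).
have := derivation_retag (training d) (algorithm d) der.
by rewrite /retag /= dcd tcd; case: (d).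
Qed.

Lemma JT_derived (outa outb : system S TS LA -> value S -> {i01 R} -> Prop)
    n (a b : 'I_n -> system S TS LA) c d :
  (forall i, JT outa outb (a i) (b i)) ->
  mapsto rule a c -> mapsto rule b d -> target c = target d -> descr c = descr d ->
  JT (derived_out rule outa a) (derived_out rule outb b) c d.
Proof.
move=> jt ac bd tcd dcd.
have [tagc tagd] := (mapsto_tags ac, mapsto_tags bd).
split=> //.
(* A derivation has an open assumption, so some index [i] exists; [c] and [d] then differ in
   Training Set or Learning Algorithm as [a i] and [b i] do. *)
- have [i] := mapsto_inhabited ac; have [_ _ neq _] := jt i.
  by move: neq; have [-> ->] := tagc i; have [-> ->] := tagd i.
move=> v _ f; split; apply: derived_out_retag => //; move=> i; have [] := jt i => //.
- by move=> _ _ _ o w g pos; apply: (o w pos g).1.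
- by move=> -> _ _ o w g pos; apply: (o w pos g).2.
Qed.

End UniformRule.

(** * Equality of the descriptions, and conclusion *)

Lemma mapsto_cstr_descr (R : realType) (S : signature) (TS LA : Type) n
    (a b : 'I_n -> system S TS LA) c d :
  (forall i, descr (a i) = descr (b i)) ->
  (forall i, target (a i) = target (b i)) ->
  mapsto_cstr R a c -> mapsto_cstr R b d -> target c = target d ->
  descr c = descr d.
Proof.
move=> dab tab ac bd tcd; have [i0] := mapsto_inhabited ac.
(* Every [a' i] occurs among the open assumptions, so their strings are exactly those of the family,
   whatever the derivation. *)
have root e (a' : 'I_n -> system S TS LA) : mapsto_cstr R a' e ->
    is_lcp (fun x => exists i, x = sys_string (a' i)) (sys_string e) /\
    forall i, extends (descr e) (descr (a' i)).
  case=> beta [f [v [h [l [lP der]]]]]; split.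
    apply: is_lcp_ext (right_I_lcp der) => x.
    split=> [[j /lP[i ->] ->]|[i ->]]; first by exists i.
    by exists (Jud (a' i) (beta i) (f i)) => //; apply/lP; exists i.
  move=> i; apply: (right_I_descr der (p := Jud (a' i) (beta i) (f i))).
  by apply/lP; exists i.
have [[lcpc extc] [lcpd extd]] := (root _ _ ac, root _ _ bd).
apply: extends_size_eq (extc i0) _ _; first by rewrite dab.
have e : sys_string c = sys_string d.
  apply: is_lcp_uniq lcpc _; apply: is_lcp_ext lcpd => x.
  by split=> -[i ->]; exists i; rewrite /sys_string dab tab.
move/(congr1 size): e; rewrite /sys_string tcd !size_cat !size_map => /eqP.
by rewrite eqn_add2r => /eqP.
Qed.

Theorem mainTheorem7 (R : realType) (S : signature) (TS LA : Type)
    (out : system S TS LA -> value S -> {i01 R} -> Prop)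
    (n : nat) (a b : 'I_n -> system S TS LA) (c d : system S TS LA)
    (a_JT_b : forall i, JT out out (a i) (b i))
    (target_dc : target d = target c) :
  (mapsto_cstr R a c -> mapsto_cstr R b d ->
     (forall delta, possible (target c) delta -> forall f,
        cstr_out out a c delta f <-> cstr_out out b d delta f) /\
     JT (cstr_out out a) (cstr_out out b) c d) /\
  (mapsto_decstr R a c -> mapsto_decstr R b d -> descr c = descr d ->
     (forall delta, possible (target c) delta -> forall f,
        decstr_out out a c delta f <-> decstr_out out b d delta f) /\
     JT (decstr_out out a) (decstr_out out b) c d).
Proof.
have jt_iff rule : JT (derived_out rule out a) (derived_out rule out b) c d ->
    (forall delta, possible (target c) delta -> forall f,
       derived_out rule out a c delta f <-> derived_out rule out b d delta f) /\
    JT (derived_out rule out a) (derived_out rule out b) c d.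
  by move=> jt; split=> //; have [] := jt.
(* For I-rules the descriptions agree by the string argument. E-rules such as E→ and E×1b lengthen
   the list; there the agreement is the hypothesis [dcd]. *)
split=> [ac bd|ac bd dcd]; apply: jt_iff.
  apply: JT_derived => //; first exact: right_I_uniform.
  by apply: mapsto_cstr_descr ac bd _ => // i; have [] := a_JT_b i.
by apply: JT_derived => //; exact: right_E_uniform.
Qed.
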